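(* Let $\tilde x_t := \mathbb{E}[x_t \mid \mathfrak{Y}^s_t]$. Then, for every $t \in \mathbb{N}_0$, $$\tilde x_t = s_t \hat x_t + (1-s_t)\left(A \tilde x_{t-1} + B u^a_{t-1}\right),$$ with the conventions $\tilde x_{-1} = 0$ and $u^a_{-1} = 0$.
   Context: System: $x_{t+1} = A x_t + B u^a_t + w_t$, $y_t = C x_t + \varsigma_t$, $t \in \mathbb{N}_0$, with $x_t \in \mathbb{R}^d$, applied control $u^a_t \in \mathbb{R}^m$, $y_t\in\mathbb{R}^q$, and known matrices $A,B,C$; $(A,B)$ is stabilizable, $(A,C)$ observable, $(A,\Sigma_w^{1/2})$ controllable. The random vectors $x_0\sim N(0,\Sigma_{x_0})$, $w_t\sim N(0,\Sigma_w)$, $\varsigma_t\sim N(0,\Sigma_\varsigma)$ ($t\in\mathbb{N}_0$) are mutually independent, with $\Sigma_{x_0}\succeq 0$, $\Sigma_w\succeq 0$, $\Sigma_\varsigma\succ 0$. All eigenvalues of $A$ lie in the closed unit disk and those on the unit circle are semi-simple. Channels: the sensor-channel dropouts $(s_t)$ and control-channel dropouts $(\nu_t)$ are i.i.d. $\{0,1\}$-valued Bernoulli processes (value $1$ = successful transmission) with success probabilities $p_s>0$ and $p_c>0$; they are mutually independent and independent of the process noise and measurement noise processes. Filter at the sensor: $\mathfrak{Y}_t := \{y_0,\dots,y_t,u^a_0,\dots,u^a_{t-1}\}$ and $\hat x_t := \mathbb{E}[x_t\mid \mathfrak{Y}_t]$ (Kalman filter estimate). The pair $(\hat x_t,y_t)$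 is sent through the sensor channel and received iff $s_t=1$. Data at the estimator/controller: $\mathcal{M}_t := \{s_t y_t,\, s_t\hat x_t,\, s_t,\, u^a_{t-1}\}$, $\mathfrak{Y}^s_t := \{\mathcal{M}_0,\dots,\mathcal{M}_t\}$, with the convention $u^a_{-1}=0$. Acknowledgements of successfully transmitted control commands are causally available to the controller and the estimator. The control commands are computed causally by the controller from the data available to it, are sent through the control channel, and the applied control $u^a_t$ is determined by these commands and the control-channel dropouts up to time $t$.
   Formalization: The dropouts are assumed independent of the initial state x_0 too (all of x_0, w_t, ς_t, s_t, ν_t mutually independent); without this the claim fails at t = 0, e.g. for s_0 = 1 exactly when x_0 > 0. *)

(* Defs.v *)
From HB Require Import structures.
From mathcomp Require Import all_boot all_order all_algebra.
From mathcomp Require Import complex.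
From mathcomp Require Import all_classical all_reals all_analysis.

Set Implicit Arguments.
Unset Strict Implicit.
Unset Printing Implicit Defensive.

Import Order.TTheory GRing.Theory Num.Theory.
Import numFieldNormedType.Exports.

Local Open Scope classical_set_scope.
Local Open Scope ring_scope.

Section LinearSystems.
Context {R : realType}.

Definition quad_form n (S : 'M[R]_n) (a : 'cV[R]_n) : R :=
  (a^T *m S *m a) ord0 ord0.

Definition psd n (S : 'M[R]_n) : Prop :=
  S^T = S /\ forall a : 'cV[R]_n, 0 <= quad_form S a.

Definition posdef n (S : 'M[R]_n) : Prop :=
  S^T = S /\ forall a : 'cV[R]_n, a != 0 -> 0 < quad_form S a.

Definition complexify n (A : 'M[R]_n) : 'M[R[i]]_n := map_mx (real_complex R) A.

Definition schur_stable n (A : 'M[R]_n) : Prop :=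
  forall l : R[i], eigenvalue (complexify A) l -> `|l| < 1.

(* Semi-simple: the algebraic multiplicity equals the geometric one. *)
Definition marginally_stable n (A : 'M[R]_n) : Prop :=
  forall l : R[i], eigenvalue (complexify A) l ->
    `|l| <= 1 /\
    (`|l| = 1 ->
     mup l (char_poly (complexify A)) = \rank (eigenspace (complexify A) l)).

Definition stabilizable n m (A : 'M[R]_n) (B : 'M[R]_(n, m)) : Prop :=
  exists K : 'M[R]_(m, n), schur_stable (A + B *m K).

Fixpoint trajectory n m (A : 'M[R]_n) (B : 'M[R]_(n, m)) (z : 'cV[R]_n)
    (u : nat -> 'cV[R]_m) (t : nat) : 'cV[R]_n :=
  if t is k.+1 then A *m trajectory A B z u k + B *m u k else z.

Definition controllable n m (A : 'M[R]_n) (B : 'M[R]_(n, m)) : Prop :=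
  forall z z' : 'cV[R]_n,
    exists (N : nat) (u : nat -> 'cV[R]_m), trajectory A B z u N = z'.

(* The unforced state at time t is A ^+ t *m z. *)
Definition observable n q (A : 'M[R]_n) (C : 'M[R]_(q, n)) : Prop :=
  forall z z' : 'cV[R]_n,
    (forall t : nat, C *m (A ^+ t *m z) = C *m (A ^+ t *m z')) -> z = z'.

End LinearSystems.

Section Probability.
Context {d : measure_display} {Omega : measurableType d} {R : realType}.
Variable P : probability Omega R.

Definition entry n (X : Omega -> 'cV[R]_n) (i : 'I_n) : Omega -> R :=
  fun w => X w i ord0.

Definition sigma_of d' (T : measurableType d') (X : Omega -> T) :
  set (set Omega) := preimage_set_system setT X measurable.

(* 'cV[R]_n carries no canonical sigma-algebra in the library; this is the
   preimage under X of the Borel sigma-algebra of R^n, which the coordinates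
   generate. *)
Definition sigma_vec n (X : Omega -> 'cV[R]_n) : set (set Omega) :=
  g_sigma_preimage (entry X).

Definition random_vector n (X : Omega -> 'cV[R]_n) : Prop :=
  forall i, measurable_fun setT (entry X i).

Definition mutually_independent (I : eqType) (F : I -> set (set Omega)) : Prop :=
  forall (J : seq I) (E : I -> set Omega), uniq J ->
    (forall i, i \in J -> F i (E i)) ->
    fine (P (\big[setI/setT]_(i <- J) E i)) = \prod_(i <- J) fine (P (E i)).

(* X ~ N(0, S), S possibly singular: each a^T X is N(0, a^T S a), a null variance
   meaning a unit mass at 0. The second parameter of normal_prob is the standard
   deviation; at 0 normal_prob is not a point mass, hence the case split. *)
Definition centered_gaussian n (X : Omega -> 'cV[R]_n) (S : 'M[R]_n) : Prop :=
  random_vector X /\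
  forall (a : 'cV[R]_n) (E : set R), measurable E ->
    P [set w | E ((a^T *m X w) ord0 ord0)] =
    if quad_form S a == 0 then dirac (0 : R) E
    else normal_prob 0 (Num.sqrt (quad_form S a)) E.

Definition bernoulli_rv (p : R) (X : Omega -> bool) : Prop :=
  measurable_fun setT X /\
  forall E : set bool, P (X @^-1` E) = bernoulli_prob p E.

(* Z is a version of E[X | G]. *)
Definition is_cond_exp n (G : set (set Omega)) (X Z : Omega -> 'cV[R]_n) : Prop :=
  sigma_vec Z `<=` G /\
  forall i : 'I_n,
    [/\ P.-integrable setT (EFin \o entry X i),
        P.-integrable setT (EFin \o entry Z i) &
        forall E, G E ->
          (\int[P]_(w in E) (entry Z i w)%:E
           = \int[P]_(w in E) (entry X i w)%:E)%E].

End Probability.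

(* The sources of randomness: initial state, process noise, measurement noise,
   sensor-channel dropouts and control-channel dropouts. *)
Inductive source : Type :=
  | InitialState
  | ProcessNoise of nat
  | MeasurementNoise of nat
  | SensorDropout of nat
  | ControlDropout of nat.

HB.instance Definition _ := gen_eqMixin source.

Section Network.
Context {d : measure_display} {Omega : measurableType d} {R : realType}.

Definition source_sigma n q (x0 : Omega -> 'cV[R]_n)
    (wn : nat -> Omega -> 'cV[R]_n) (vn : nat -> Omega -> 'cV[R]_q)
    (s nu : nat -> Omega -> bool) (i : source) : set (set Omega) :=
  match i with
  | InitialState => sigma_vec x0
  | ProcessNoise t => sigma_vec (wn t)
  | MeasurementNoise t => sigma_vec (vn t)
  | SensorDropout t => sigma_of (s t)
  | ControlDropout t => sigma_of (nu t)
  end.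

(* X_{t-1}, with X_{-1} = 0. *)
Definition delayed n (X : nat -> Omega -> 'cV[R]_n) (t : nat) : Omega -> 'cV[R]_n :=
  if t is k.+1 then X k else fun=> 0.

(* sigma(y_0, .., y_t, u_0, .., u_{t-1}) *)
Definition sensor_info q m (y : nat -> Omega -> 'cV[R]_q)
    (u : nat -> Omega -> 'cV[R]_m) (t : nat) : set (set Omega) :=
  <<s (\bigcup_(i in `I_t.+1) sigma_vec (y i)) `|`
      (\bigcup_(i in `I_t) sigma_vec (u i)) >>.

(* Generators of sigma(s_t y_t, s_t xhat_t, s_t, u_{t-1}). *)
Definition message n m q (s : nat -> Omega -> bool)
    (y : nat -> Omega -> 'cV[R]_q) (xhat : nat -> Omega -> 'cV[R]_n)
    (u : nat -> Omega -> 'cV[R]_m) (t : nat) : set (set Omega) :=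
  sigma_vec (fun w => (s t w)%:R *: y t w) `|`
  sigma_vec (fun w => (s t w)%:R *: xhat t w) `|`
  sigma_of (s t) `|`
  sigma_vec (delayed u t).

Definition estimator_info n m q (s : nat -> Omega -> bool)
    (y : nat -> Omega -> 'cV[R]_q) (xhat : nat -> Omega -> 'cV[R]_n)
    (u : nat -> Omega -> 'cV[R]_m) (t : nat) : set (set Omega) :=
  <<s \bigcup_(i in `I_t.+1) message s y xhat u i >>.

(* The acknowledgements available when the command of time t is computed are
   nu_0, .., nu_{t-1}. *)
Definition controller_info n m q (s nu : nat -> Omega -> bool)
    (y : nat -> Omega -> 'cV[R]_q) (xhat : nat -> Omega -> 'cV[R]_n)
    (u : nat -> Omega -> 'cV[R]_m) (t : nat) : set (set Omega) :=
  <<s estimator_info s y xhat u t `|` \bigcup_(i in `I_t) sigma_of (nu i) >>.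

Definition actuator_info d' (U : measurableType d') (cmd : nat -> Omega -> U)
    (nu : nat -> Omega -> bool) (t : nat) : set (set Omega) :=
  <<s \bigcup_(i in `I_t.+1) (sigma_of (cmd i) `|` sigma_of (nu i)) >>.

End Network.

(* Main.v *)
(* Split the state as x_t = free_t + forced_t, where free_t is driven by x_0 and
   the process noise and forced_t is a linear function of the past controls; let
   y0_t = C free_t + v_t be the control-free output. By causality, everything the
   sensor and the estimator know is a function of (y0_k) and of the dropouts.

   Since (free_t, y0_0, .., y0_t) is independent of the dropouts, a version g of
   E[free_t | y0_0, .., y0_t] remains a conditional expectation when all dropouts
   are added to the conditioning, and g + forced_t is sensor-measurable; by
   uniqueness it equals xhat_t, so xhat_t = E[x_t | sensor data, all dropouts].

   The recursion is then proved by induction on t, together with the stronger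
   claim xtilde_t = E[x_t | estimator data up to t, all control dropouts]. On
   {s_t = 1} this is the statement about xhat_t. On {s_t = 0} the estimator learns
   nothing beyond time t-1 except u_{t-1}, which is a function of the data of
   time t-1 and of the control dropouts, and both s_t and w_{t-1} are independent
   of all of these; so the prediction A xtilde_{t-1} + B u_{t-1} is a version of
   the conditional expectation. *)

Require Import Defs.
From HB Require Import structures.
From mathcomp Require Import all_boot all_order all_algebra.
From mathcomp Require Import complex.
From mathcomp Require Import all_classical all_reals all_analysis.
From mathcomp Require Import measurable_realfun.
From mathcomp Require Import ring.

Set Implicit Arguments.
Unset Strict Implicit.
Unset Printing Implicit Defensive.

Import Order.TTheory GRing.Theory Num.Theory.
Import numFieldNormedType.Exports.

Local Open Scope classical_set_scope.
Local Open Scope ring_scope.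

(** * Measurability with respect to a generated sigma-algebra *)

Section SubSigmaAlgebras.
Context {d : measure_display} {Omega : measurableType d} {R : realType}.
Implicit Types (G H : set (set Omega)) (f g : Omega -> R).

(** Measurability is stated on the measurable type generated by [G], so that closure of measurable
    functions under arithmetic applies unchanged. [G] is only a generating family; the sigma-algebra
    meant is [<<s G >>]. *)
Definition adapted G f : Prop :=
  measurable_fun [set: g_sigma_algebraType G] (f : g_sigma_algebraType G -> R).

Lemma sub_gen_sigma G H : G `<=` <<s H >> -> <<s G >> `<=` <<s H >>.
Proof. by move=> GH; apply: smallest_sub => //; exact: smallest_sigma_algebra. Qed.

Lemma sub_gen_measurable G : G `<=` measurable -> <<s G >> `<=` measurable.
Proof. by move=> Gm; apply: smallest_sub => //; exact: sigma_algebra_measurable. Qed.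

Lemma adaptedP G f :
  adapted G f <-> forall B, measurable B -> <<s G >> (f @^-1` B).
Proof.
split=> [mf B mB | mf _ B mB]; last by rewrite setTI; exact: mf.
by have := mf measurableT B mB; rewrite setTI.
Qed.

Lemma adapted_sub G H f : G `<=` <<s H >> -> adapted G f -> adapted H f.
Proof.
by move=> GH /adaptedP Gf; apply/adaptedP => B mB; apply: (sub_gen_sigma GH); exact: Gf.
Qed.

Lemma adapted_measurable G f :
  G `<=` measurable -> adapted G f -> measurable_fun setT f.
Proof.
move=> Gm /adaptedP Gf _ B mB; rewrite setTI.
by apply: (sub_gen_measurable Gm); exact: Gf.
Qed.

Lemma adapted_cst G c : adapted G (fun=> c).
Proof. exact: measurable_cst. Qed.

Lemma adaptedD G f g : adapted G f -> adapted G g -> adapted G (fun w => f w + g w).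
Proof. exact: measurable_funD. Qed.

Lemma adaptedB G f g : adapted G f -> adapted G g -> adapted G (fun w => f w - g w).
Proof. exact: measurable_funB. Qed.

Lemma adaptedM G f g : adapted G f -> adapted G g -> adapted G (fun w => f w * g w).
Proof. exact: measurable_funM. Qed.

Lemma adapted_sum G (I : Type) (r : seq I) (h : I -> Omega -> R) :
  (forall i, adapted G (h i)) -> adapted G (fun w => \sum_(i <- r) h i w).
Proof.
move=> Gh; elim: r => [|i r IHr].
  by under eq_fun do rewrite big_nil; exact: adapted_cst.
by under eq_fun do rewrite big_cons; exact: adaptedD.
Qed.

Lemma adapted_bool G (s : Omega -> bool) :
  sigma_of s `<=` <<s G >> -> adapted G (fun w => (s w)%:R).
Proof.
move=> Gs; apply/adaptedP => B _.
by apply: Gs; exists [set b : bool | B (b%:R : R)] => //; rewrite setTI.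
Qed.

Lemma sigma_vecP G n (X : Omega -> 'cV[R]_n) :
  sigma_vec X `<=` <<s G >> <-> forall i, adapted G (entry X i).
Proof.
split=> [GX i | GX].
  apply/adaptedP => B mB; apply: GX; apply: sub_sigma_algebra.
  by rewrite (bigD1 i)//=; left; exists B => //; rewrite setTI.
apply: sub_gen_sigma; apply: (big_ind (fun S => S `<=` <<s G >>)) => //.
- by move=> S T SG TG E [/SG|/TG].
- move=> i _ _ [B mB <-]; rewrite setTI.
  by move/adaptedP : (GX i); exact.
Qed.

Lemma adapted_mulmx G k n (M : 'M[R]_(k, n)) (X : Omega -> 'cV[R]_n) i :
  (forall j, adapted G (entry X j)) -> adapted G (entry (fun w => M *m X w) i).
Proof.
move=> GX; rewrite /entry; under eq_fun do rewrite mxE.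
by apply: adapted_sum => j; apply: adaptedM; [exact: adapted_cst|exact: GX].
Qed.

(** Events whose trace on [D] is also the trace of an event of [<<s H >>] form a sigma-algebra,
    because complements and countable unions commute with intersection by [D]. It therefore suffices
    to check generators. This serves to compare what is known on the event of a lost packet. *)
Lemma gen_sigma_trace G H (D : set Omega) :
  (forall E, G E -> exists2 E', <<s H >> E' & E `&` D = E' `&` D) ->
  forall E, <<s G >> E -> exists2 E', <<s H >> E' & E `&` D = E' `&` D.
Proof.
move=> GH; pose K := [set E | exists2 E', <<s H >> E' & E `&` D = E' `&` D].
suff: <<s G >> `<=` K by move=> sub E /sub.
apply: smallest_sub; last by move=> E /GH.
split.
- by exists set0 => //; exact: sigma_algebra0.
- move=> E [E' HE' EE']; exists (setT `\` E'); first exact: sigma_algebraCD.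
  have setCI S : (setT `\` S) `&` D = D `\` (S `&` D).
    by rewrite setDIr setDv setU0 setTD setIC setDE.
  by rewrite !setCI EE'.
- move=> F KF; have /choice[F' F'P] : forall k, exists E',
      <<s H >> E' /\ F k `&` D = E' `&` D.
    by move=> k; have [E' ? ?] := KF k; exists E'.
  exists (\bigcup_k F' k).
    by apply: sigma_algebra_bigcup => k; have [] := F'P k.
  by rewrite !setI_bigcupl; apply: eq_bigcupr => k _; have [] := F'P k.
Qed.

Lemma adapted_entryD (G : set (set Omega)) k (X Y : Omega -> 'cV[R]_k) :
  (forall i, adapted G (entry X i)) -> (forall i, adapted G (entry Y i)) ->
  forall i, adapted G (entry (fun w => X w + Y w) i).
Proof.
move=> GX GY i; rewrite /entry; under eq_fun do rewrite mxE.
by apply: adaptedD; [exact: GX|exact: GY].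
Qed.

Lemma adapted_entryZ (G : set (set Omega)) k (f : Omega -> R) (X : Omega -> 'cV[R]_k) :
  adapted G f -> (forall i, adapted G (entry X i)) ->
  forall i, adapted G (entry (fun w => f w *: X w) i).
Proof.
move=> Gf GX i; rewrite /entry; under eq_fun do rewrite mxE.
by apply: adaptedM => //; exact: GX.
Qed.

Lemma gen_sigma_setI (G : set (set Omega)) : setI_closed <<s G >>.
Proof. exact: (@measurableI _ (g_sigma_algebraType G)). Qed.

Lemma gen_sigma_setT (G : set (set Omega)) : <<s G >> setT.
Proof. exact: (@measurableT _ (g_sigma_algebraType G)). Qed.

Lemma gen_sigmaK (G : set (set Omega)) : <<s <<s G >> >> = <<s G >>.
Proof. by apply: sigma_algebra_id; exact: smallest_sigma_algebra. Qed.

(** A function constant on [D] conveys nothing there: each of its preimages contains all of [D] or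
    misses it, so [setT] or [set0] has the same trace. *)
Lemma trace_preimage_cst (G : set (set Omega)) (D : set Omega) T
    (f : Omega -> T) c (S : set T) : (forall w, D w -> f w = c) ->
  exists2 E', <<s G >> E' & f @^-1` S `&` D = E' `&` D.
Proof.
move=> fc; have [Sc|nSc] := pselect (S c).
  exists setT; first exact: gen_sigma_setT.
  by apply/seteqP; split => w [] /= _ Dw; split => //; rewrite /= fc.
exists set0; first exact: sigma_algebra0.
by apply/seteqP; split => w [] //= Sw Dw; exfalso; apply: nSc; rewrite -(fc w Dw).
Qed.

Lemma trace_sigma_vec_cst (G : set (set Omega)) (D : set Omega) k
    (X : Omega -> 'cV[R]_k) : (forall w, D w -> X w = 0) ->
  forall E, sigma_vec X E -> exists2 E', <<s G >> E' & E `&` D = E' `&` D.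
Proof.
move=> X0; apply: gen_sigma_trace.
apply: (big_ind (fun S : set (set Omega) => forall E, S E ->
  exists2 E', <<s G >> E' & E `&` D = E' `&` D)) => //.
  by move=> S T ST TT E [/ST|/TT].
move=> i _ _ [S mS <-]; rewrite setTI.
apply: (@trace_preimage_cst _ _ _ _ 0) => w Dw.
by rewrite /entry X0// mxE.
Qed.

End SubSigmaAlgebras.

(** * Independence *)

Section Independence.
Context {d : measure_display} {Omega : measurableType d} {R : realType}.
Variable P : probability Omega R.
Implicit Types (G H : set (set Omega)) (f g h : Omega -> R).
Local Open Scope ereal_scope.

Definition indep G H : Prop :=
  forall E F, G E -> H F -> P (E `&` F) = P E * P F.

(** The probability of [F] in the form of a scaling factor for a measure. *)
Definition mass F : {nonneg R} := NngNum (fine_ge0 (measure_ge0 P F)).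

Lemma massE F : measurable F -> (mass F)%:num%:E = P F.
Proof. by move=> mF; rewrite fineK// fin_num_measure. Qed.

(** Dynkin's pi-lambda argument: for fixed [F], the events that factor with [F] form a lambda-system
    containing the pi-system [G]. *)
Lemma indep_gen_l G F : setI_closed G -> G `<=` measurable -> measurable F ->
  (forall E, G E -> P (E `&` F) = P E * P F) ->
  forall E, <<s G >> E -> P (E `&` F) = P E * P F.
Proof.
move=> GI Gm mF GF.
suff: <<s G >> `<=` [set E | measurable E /\ P (E `&` F) = P E * P F].
  by move=> sub E /sub[].
apply: lambda_system_subset => //; last by move=> E GE; split; [exact: Gm|exact: GF].
apply/dynkin_lambda_system; split => /=.
- by split; [exact: measurableT|rewrite setTI probability_setT mul1e].
- move=> E [mE EF]; split; first exact: measurableC.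
  have -> : ~` E `&` F = F `\` E by rewrite setIC setDE.
  have finF : P F \is a fin_num by exact: fin_num_measure.
  have finE : P E \is a fin_num by exact: fin_num_measure.
  rewrite measureD//; last by rewrite ltey_eq finF.
  by rewrite (setIC F) [X in _ - X]EF probability_setC// muleBl// mul1e.
- move=> E tE EP; have mE k : measurable (E k) by have [] := EP k.
  split; first exact: bigcupT_measurable.
  have tEF : trivIset [set: nat] (fun k => E k `&` F).
    apply/trivIsetP => i j _ _ ij.
    move/trivIsetP : tE => /(_ i j Logic.I Logic.I ij) Eij.
    by rewrite setIACA Eij set0I.
  rewrite setI_bigcupl (measure_bigcup P setT (fun k => E k `&` F))//; last first.
    by move=> k _; exact: measurableI.
  rewrite (measure_bigcup P setT E)// muleC -(massE mF) -nneseriesZl//.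
  by apply: eq_eseriesr => k _; have [_ EkF] := EP k; rewrite massE// muleC; exact: EkF.
Qed.

Lemma indep_gen G H : setI_closed G -> setI_closed H ->
  G `<=` measurable -> H `<=` measurable ->
  indep G H -> indep <<s G >> <<s H >>.
Proof.
move=> GI HI Gm Hm GH E F GE HF.
apply: (indep_gen_l GI Gm) => //; first exact: (sub_gen_measurable Hm).
move=> A GA; rewrite setIC muleC; apply: (indep_gen_l HI Hm) => //; first exact: Gm.
by move=> B HB; rewrite setIC muleC; exact: GH.
Qed.

(** [E] is split along [D]: the restricted measure vanishes outside [D] and coincides with [P]
    inside. *)
Lemma ge0_integral_mrestr (D : set Omega) (mD : measurable D) (f : Omega -> \bar R) E :
  measurable E -> measurable_fun setT f -> (forall w, 0 <= f w) ->
  \int[mrestr P mD]_(w in E) f w = \int[P]_(w in E `&` D) f w.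
Proof.
move=> mE mf f0; have mED := measurableI _ _ mE mD.
have mEnD : measurable (E `\` D) by exact: measurableD.
rewrite -{1}(setUIDK E D) ge0_integral_setU//=; last 2 first.
- exact: measurable_funTS.
- by apply/disj_setPS => w [[_ ?] [_ ?]].
rewrite [X in _ + X](@eq_measure_integral _ _ _ _ mzero); last first.
  move=> A mA AED; change (P (A `&` D) = 0); rewrite (_ : A `&` D = set0) ?measure0//.
  by apply/seteqP; split => w // [/AED[]].
rewrite integral_measure_zero adde0; apply: eq_measure_integral => A mA AED.
change (P (A `&` D) = P A); by rewrite setIidl// => w /AED[].
Qed.

(** On [<<s G >>] the restriction of [P] to [F] is [P F] times [P]. Both measures are pushed forward
    along the identity to the coarser space, where they agree on every measurable set and so
    integrate [f] alike. *)
Lemma ge0_integral_indep G (F : set Omega) (f : Omega -> \bar R) E :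
  G `<=` measurable -> measurable F ->
  (forall A, <<s G >> A -> P (A `&` F) = P A * P F) ->
  measurable_fun [set: g_sigma_algebraType G] (f : g_sigma_algebraType G -> \bar R) ->
  (forall w, 0 <= f w) -> <<s G >> E ->
  \int[P]_(w in E `&` F) f w = P F * \int[P]_(w in E) f w.
Proof.
move=> Gm mF GF mf f0 GE.
have mid : measurable_fun [set: Omega] (id : Omega -> g_sigma_algebraType G).
  by move=> _ B mB; rewrite setTI; exact: (sub_gen_measurable Gm).
have mf' : measurable_fun [set: Omega] f by exact: (measurableT_comp mf mid).
have mE := sub_gen_measurable Gm GE.
have mE' : measurable (E : set (g_sigma_algebraType G)) by exact: GE.
pose sub : Omega -> g_sigma_algebraType G := id.
transitivity (\int[pushforward (mrestr P mF) sub]_(w in E) f w).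
  rewrite ge0_integral_pushforward//=; last exact: measurable_funTS.
  by rewrite ge0_integral_mrestr.
rewrite -(massE mF) -ge0_integral_mscale//; last exact: measurable_funTS.
transitivity (\int[pushforward (mscale (mass F) P) sub]_(w in E) f w); last first.
  by rewrite ge0_integral_pushforward//=; exact: measurable_funTS.
apply: eq_measure_integral => A mA _.
change (P (A `&` F) = (mass F)%:num%:E * P A).
by rewrite GF// massE// muleC.
Qed.

Lemma integral_indep G F f E :
  G `<=` measurable -> measurable F ->
  (forall A, <<s G >> A -> P (A `&` F) = P A * P F) ->
  adapted G f -> P.-integrable setT (EFin \o f) -> <<s G >> E ->
  \int[P]_(w in E `&` F) (f w)%:E = P F * \int[P]_(w in E) (f w)%:E.
Proof.
move=> Gm mF GF Gf intf GE; rewrite integralE [X in _ = _ * X]integralE.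
have Gf' : measurable_fun [set: g_sigma_algebraType G]
    (EFin \o f : g_sigma_algebraType G -> \bar R) by exact/measurable_EFinP.
rewrite !(ge0_integral_indep Gm mF GF)//; last 2 first.
- exact: measurable_funeneg.
- exact: measurable_funepos.
have mE := sub_gen_measurable Gm GE.
rewrite -(massE mF) [RHS]muleBr//; apply: fin_num_adde_defr.
apply: integrable_fin_num => //.
by apply: integrable_funepos => //; exact: integrableS intf.
Qed.

End Independence.

(** * Conditional expectation *)

Section ConditionalExpectation.
Context {d : measure_display} {Omega : measurableType d} {R : realType}.
Variable P : probability Omega R.
Implicit Types (G H : set (set Omega)) (f g h : Omega -> R).
Local Open Scope ereal_scope.

(** For integrable [h] and a sigma-algebra [G] this says that the conditional expectation of [h]
    given [G] is zero, without choosing a version of it. *)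
Definition null_on G h : Prop := forall E, G E -> \int[P]_(w in E) (h w)%:E = 0.

Section Restriction.
Variables (G : set (set Omega)) (Gm : G `<=` measurable).

Lemma measurable_sub_id :
  measurable_fun [set: Omega] (id : Omega -> g_sigma_algebraType G).
Proof. by move=> _ B mB; rewrite setTI; exact: (sub_gen_measurable Gm). Qed.

Let sub_mfun : {mfun Omega >-> g_sigma_algebraType G} :=
  HB.pack (id : Omega -> g_sigma_algebraType G)
    (isMeasurableFun.Build _ _ _ _ _ measurable_sub_id).

(** The restriction of [P] to [<<s G >>], obtained as the law of the identity map into the coarser
    space. *)
Let Q := distribution P sub_mfun.

Let Q_integrable (f : Omega -> \bar R) : P.-integrable setT f ->
  measurable_fun [set: g_sigma_algebraType G] (f : g_sigma_algebraType G -> \bar R) ->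
  Q.-integrable setT f.
Proof. by move=> intf mf; exact: (integrable_pushforward measurable_sub_id). Qed.

Let Q_integral (f : Omega -> \bar R) E : P.-integrable setT f ->
  measurable_fun [set: g_sigma_algebraType G] (f : g_sigma_algebraType G -> \bar R) ->
  <<s G >> E -> \int[Q]_(w in E) f w = \int[P]_(w in E) f w.
Proof.
move=> intf mf GE.
have mE : measurable (E : set (g_sigma_algebraType G)) by exact: GE.
apply: (integral_pushforward measurable_sub_id) => //.
by apply: integrableS intf => //; exact: (sub_gen_measurable Gm).
Qed.

(** The conditional expectation is the Radon-Nikodym density, with respect to [Q], of the charge
    with density [f] restricted to [<<s G >>]. The density is finite everywhere, so passing to
    [fine] changes no value. *)
Lemma cond_exp_exists f : P.-integrable setT (EFin \o f) ->
  exists g, [/\ adapted G g, P.-integrable setT (EFin \o g) &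
    forall E, <<s G >> E ->
      \int[P]_(w in E) (g w)%:E = \int[P]_(w in E) (f w)%:E].
Proof.
move=> intf.
pose nu : {charge set _ -> \bar R} := induced_charge intf.
pose nuG : {charge set (g_sigma_algebraType G) -> \bar R} :=
  pushforward nu sub_mfun.
pose nuQ := nuG measurable_sub_id.
have dom : nuQ `<< Q.
  apply: (dominates_pushforward measurable_sub_id).
  apply/null_content_dominatesP => A mA PA.
  apply: null_set_integral => //.
  by apply: measurable_funTS; exact: measurable_int intf.
have RNfin w := Radon_Nikodym_fin_num w dom.
have RNint := Radon_Nikodym_integrable dom.
set rn := Radon_Nikodym nuQ Q in RNfin RNint.
have mrn := measurable_int _ RNint.
have fineE : EFin \o (fun w => fine (rn w)) = rn.
  by apply/funext => w /=; rewrite fineK.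
have intrn : P.-integrable setT rn.
  apply/integrableP; split; first exact: measurableT_comp mrn measurable_sub_id.
  have /integrableP[_] := RNint.
  rewrite ge0_integral_pushforward//=.
    exact: measurable_sub_id.
  exact: (measurableT_comp (@abse_measurable R setT) mrn).
exists (fun w => fine (rn w)); split.
- by apply/measurable_EFinP; rewrite fineE.
- by rewrite fineE.
- move=> E GE; transitivity (\int[P]_(w in E) rn w).
    by apply: eq_integral => w _; rewrite fineK.
  by rewrite -Q_integral// -Radon_Nikodym_integral.
Qed.

Lemma cond_exp_unique f g : adapted G f -> adapted G g ->
  P.-integrable setT (EFin \o f) -> P.-integrable setT (EFin \o g) ->
  (forall E, <<s G >> E ->
     \int[P]_(w in E) (f w)%:E = \int[P]_(w in E) (g w)%:E) ->
  {ae P, forall w, f w = g w}.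
Proof.
move=> Gf Gg intf intg fg.
have mf : measurable_fun [set: g_sigma_algebraType G]
  (EFin \o f : g_sigma_algebraType G -> \bar R) by exact/measurable_EFinP.
have mg : measurable_fun [set: g_sigma_algebraType G]
  (EFin \o g : g_sigma_algebraType G -> \bar R) by exact/measurable_EFinP.
have : ae_eq Q setT (EFin \o f) (EFin \o g).
  apply: integral_ae_eq => //; first exact: Q_integrable.
  by move=> E _ mE; rewrite !Q_integral//; exact: fg.
case=> N [mN QN sN]; exists N; split => //; first exact: (sub_gen_measurable Gm).
move=> w /= nfg; apply: sN => /= /(_ Logic.I) [].
exact: nfg.
Qed.

End Restriction.

(** The intersections [E] with [F] form a pi-system, which generates [<<s G]|[H >>] because [setT]
    belongs to both families. The events over which [h] integrates to zero form a lambda-system, the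
    whole space being one of them. *)
Lemma null_onU G H h :
  G `<=` measurable -> H `<=` measurable -> setI_closed G -> setI_closed H ->
  G setT -> H setT -> P.-integrable setT (EFin \o h) ->
  (forall E F, G E -> H F -> \int[P]_(w in E `&` F) (h w)%:E = 0) ->
  null_on <<s G `|` H >> h.
Proof.
move=> Gm Hm GI HI GT HT inth GH.
pose K := [set E `&` F | E in G & F in H].
have -> : <<s G `|` H >> = <<s K >>.
  apply/seteqP; split.
    apply: sub_gen_sigma => E [GE|HE]; apply: sub_sigma_algebra.
      by exists E => //; exists setT => //; rewrite setIT.
    by exists setT => //; exists E => //; rewrite setTI.
  apply: sub_gen_sigma => _ [E GE] [F HF] <-.
  apply: (@measurableI _ (g_sigma_algebraType (G `|` H))).
    by apply: sub_sigma_algebra; left.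
  by apply: sub_sigma_algebra; right.
have intS E : measurable E -> P.-integrable E (EFin \o h).
  by move=> mE; exact: integrableS inth.
suff: <<s K >> `<=` [set E | measurable E /\ \int[P]_(w in E) (h w)%:E = 0].
  by move=> sub E /sub[].
apply: lambda_system_subset => //.
- move=> _ _ [E1 GE1] [F1 HF1] <- [E2 GE2] [F2 HF2] <-.
  exists (E1 `&` E2); first exact: GI.
  by exists (F1 `&` F2); [exact: HI|rewrite setIACA].
- apply/dynkin_lambda_system; split => /=.
  + split; first exact: measurableT.
    by rewrite -(setIT setT); exact: GH.
  + move=> E [mE hE]; split; first exact: measurableC.
    have : \int[P]_(w in setT) (h w)%:E = 0 by rewrite -(setIT setT); exact: GH.
    rewrite -(setUv E) integral_setU//.
    * by rewrite hE add0e.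
    * exact: measurableC.
    * by rewrite setUv; exact: (measurable_int P inth).
    * by apply/disj_setPCl.
  + move=> E tE hE; have mE k : measurable (E k) by have [] := hE k.
    split; first exact: bigcupT_measurable.
    rewrite integral_bigcup//; last by apply: intS; exact: bigcupT_measurable.
    by rewrite eseries0// => k _ _; have [] := hE k.
- move=> _ [E GE] [F HF] <-; split; last exact: GH.
  by apply: measurableI; [exact: Gm|exact: Hm].
Qed.

End ConditionalExpectation.

(** * Integrability and null integrals of random vectors, entry by entry *)

Section VectorIntegrals.
Context {d : measure_display} {Omega : measurableType d} {R : realType}.
Variable P : probability Omega R.
Implicit Types (G : set (set Omega)).

Lemma entryM k l (M : 'M[R]_(k, l)) (X : Omega -> 'cV[R]_l) i w :
  entry (fun w => M *m X w) i w = \sum_j M i j * entry X j w.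
Proof. by rewrite /entry mxE. Qed.

Lemma integrable_mulmx k l (M : 'M[R]_(k, l)) (X : Omega -> 'cV[R]_l) :
  (forall j, P.-integrable setT (EFin \o entry X j)) ->
  forall i, P.-integrable setT (EFin \o entry (fun w => M *m X w) i).
Proof.
move=> intX i.
rewrite (_ : EFin \o _ = (fun w => \sum_j (M i j)%:E * (entry X j w)%:E)%E).
  by apply: integrable_sum => // j _; apply: integrableZl => //; exact: intX.
by apply/funext => w /=; rewrite entryM -sumEFin.
Qed.

Lemma null_on_mulmx G k l (M : 'M[R]_(k, l)) (X : Omega -> 'cV[R]_l) :
  G `<=` measurable -> (forall j, P.-integrable setT (EFin \o entry X j)) ->
  (forall j, null_on P G (entry X j)) ->
  forall i, null_on P G (entry (fun w => M *m X w) i).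
Proof.
move=> Gm intX GX i E GE; have mE := Gm _ GE.
have intE j : P.-integrable E (EFin \o entry X j) by exact: integrableS (intX j).
transitivity (\int[P]_(w in E) \sum_j (M i j)%:E * (entry X j w)%:E)%E.
  by apply: eq_integral => w _; rewrite entryM -sumEFin.
rewrite integral_sum//; last by move=> j; exact: integrableZl (intE j).
rewrite big1// => j _.
by rewrite (integralZl mE (intE j)) [X in (_ * X)%E](GX j E GE) mule0.
Qed.

Lemma integrable_entryD k (X Y : Omega -> 'cV[R]_k) i :
  P.-integrable setT (EFin \o entry X i) -> P.-integrable setT (EFin \o entry Y i) ->
  P.-integrable setT (EFin \o entry (fun w => X w + Y w) i).
Proof.
move=> intX intY; rewrite (_ : EFin \o _ = (EFin \o entry X i) \+ (EFin \o entry Y i))%E.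
  exact: integrableD.
by apply/funext => w; rewrite /entry/= mxE EFinD.
Qed.

Lemma entryB k (X Y : Omega -> 'cV[R]_k) i :
  entry (fun w => X w - Y w) i = (fun w => entry X i w - entry Y i w).
Proof. by apply/funext => w; rewrite /entry !mxE. Qed.

Lemma integrable_entryB k (X Y : Omega -> 'cV[R]_k) i :
  P.-integrable setT (EFin \o entry X i) -> P.-integrable setT (EFin \o entry Y i) ->
  P.-integrable setT (EFin \o entry (fun w => X w - Y w) i).
Proof.
move=> intX intY; rewrite (_ : EFin \o _ = (EFin \o entry X i) \- (EFin \o entry Y i))%E.
  exact: integrableB.
by apply/funext => w; rewrite /entry/= !mxE EFinB.
Qed.

Lemma integrable_entryZ k (b : Omega -> R) (X : Omega -> 'cV[R]_k) i :
  measurable_fun setT b -> (forall w, `|b w| <= 1) ->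
  P.-integrable setT (EFin \o entry X i) ->
  P.-integrable setT (EFin \o entry (fun w => b w *: X w) i).
Proof.
move=> mb b1 intX; have mX : measurable_fun setT (entry X i).
  by apply/measurable_EFinP; exact: measurable_int intX.
have -> : entry (fun w => b w *: X w) i = (fun w => b w * entry X i w).
  by apply/funext => w; rewrite /entry mxE.
apply: le_integrable intX => //.
  by apply/measurable_EFinP; exact: measurable_funM.
by move=> w _; rewrite lee_fin normrM ler_piMl.
Qed.

Lemma null_onB G (f g : Omega -> R) : G `<=` measurable ->
  P.-integrable setT (EFin \o f) -> P.-integrable setT (EFin \o g) ->
  null_on P G (fun w => f w - g w) <->
  (forall E, G E -> \int[P]_(w in E) (g w)%:E = \int[P]_(w in E) (f w)%:E)%E.
Proof.
move=> Gm intf intg.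
have key E : G E -> (\int[P]_(w in E) (f w - g w)%:E =
    \int[P]_(w in E) (f w)%:E - \int[P]_(w in E) (g w)%:E)%E.
  move=> /Gm mE.
  have intS h : P.-integrable setT (EFin \o h) -> P.-integrable E (EFin \o h).
    by move=> inth; exact: integrableS inth.
  rewrite -(integralB mE (intS _ intf) (intS _ intg)).
  by apply: eq_integral => w _; rewrite EFinB.
have fin E (h : Omega -> R) : G E -> P.-integrable setT (EFin \o h) ->
    (\int[P]_(w in E) (h w)%:E)%E \is a fin_num.
  by move=> /Gm mE inth; apply: integrable_fin_num => //; exact: integrableS inth.
split=> [null E GE|eqfg E GE].
  have := null E GE; rewrite key// => /eqP.
  by rewrite sube_eq ?add0e ?fin// ?fin_num_adde_defl ?fin// => /eqP ->.
by rewrite key// eqfg// subee// fin.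
Qed.

Lemma entry0_int k i : P.-integrable setT (EFin \o entry (fun=> 0 : 'cV[R]_k) i).
Proof.
rewrite (_ : _ \o _ = cst 0%E); first exact: integrable0.
by apply/funext => w; rewrite /entry/= mxE.
Qed.

End VectorIntegrals.

(** * Grouping of mutually independent families *)

Section MutualIndependence.
Context {d : measure_display} {Omega : measurableType d} {R : realType}.
Variables (P : probability Omega R) (I : eqType) (F : I -> set (set Omega)).
Hypothesis Falg : forall i, sigma_algebra setT (F i).
Hypothesis Fm : forall i, F i `<=` measurable.
Hypothesis Findep : mutually_independent P F.
Implicit Type J K : set I.

Let bigsetIP (l : seq I) (A : I -> set Omega) w :
  (\big[setI/setT]_(i <- l) A i) w <-> forall i, i \in l -> A i w.
Proof.
elim: l => [|j l IHl]; first by rewrite big_nil.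
rewrite big_cons; split=> [[Aj /IHl Al] i|Al].
  by rewrite inE => /predU1P[->//|]; exact: Al.
by split; [exact: Al (mem_head _ _)|apply/IHl => i il; apply: Al; rewrite inE il orbT].
Qed.

Let FT i : F i setT.
Proof. by have [F0 FC _] := Falg i; rewrite -(setD0 setT); exact: FC. Qed.

Let FI i : setI_closed (F i).
Proof.
have <- := sigma_algebra_id (Falg i).
exact: (@measurableI _ (g_sigma_algebraType (F i))).
Qed.

Let meets J : set (set Omega) := [set E | exists l (A : I -> set Omega),
  [/\ uniq l, forall i, i \in l -> J i, forall i, i \in l -> F i (A i) &
      E = \big[setI/setT]_(i <- l) A i]].

Let meetsI J : setI_closed (meets J).
Proof.
move=> _ _ [l [A [_ lJ lA ->]]] [l' [A' [_ lJ' lA' ->]]].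
(* The two index lists are merged without repetition; an index missing from one list contributes
   [setT] on that side. *)
exists (undup (l ++ l')), (fun i => (if i \in l then A i else setT) `&`
  (if i \in l' then A' i else setT)); split.
- exact: undup_uniq.
- by move=> i; rewrite mem_undup mem_cat => /orP[/lJ|/lJ'].
- move=> i _; apply: FI; case: ifPn => [?|_];
    by [exact: lA|exact: lA'|exact: FT].
- apply/seteqP; split=> w.
    move=> [/bigsetIP Al /bigsetIP Al']; apply/bigsetIP => i _.
    by split; case: ifPn => // ?; [exact: Al|exact: Al'].
  move=> /bigsetIP Aw; split; apply/bigsetIP => i il.
    by have := Aw i; rewrite mem_undup mem_cat il => /(_ isT)[].
  by have := Aw i; rewrite mem_undup mem_cat il orbT => /(_ isT)[].
Qed.

Let meets_measurable J : meets J `<=` measurable.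
Proof.
move=> _ [l [A [_ _ lA ->]]]; rewrite big_seq.
by apply: bigsetI_measurable => i il; apply: (@Fm i); exact: lA.
Qed.

(** Finite intersections of events from the families in [J], respectively [K], are generating
    pi-systems, so only such intersections have to be shown independent. *)
Lemma indep_families J K : J `&` K = set0 ->
  indep P <<s \bigcup_(i in J) F i >> <<s \bigcup_(i in K) F i >>.
Proof.
move=> JK.
have sub_meets L : \bigcup_(i in L) F i `<=` <<s meets L >>.
  move=> E [i Li FE]; apply: sub_sigma_algebra; exists [:: i], (fun=> E); split => //.
  - by move=> j; rewrite inE => /eqP ->.
  - by move=> j; rewrite inE => /eqP ->.
  - by rewrite big_seq1.
suff ind : indep P <<s meets J >> <<s meets K >>.
  by move=> E E' /(sub_gen_sigma (sub_meets _)) EJ /(sub_gen_sigma (sub_meets _)) EK;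
    exact: ind.
apply: indep_gen; [exact: meetsI|exact: meetsI|exact: meets_measurable|
  exact: meets_measurable|].
move=> E E' JE KE'; have mE := meets_measurable JE; have mE' := meets_measurable KE'.
case: JE => l [A [ul lJ lA EE]]; case: KE' => l' [A' [ul' lK lA' EE']].
have ll' i : i \in l -> i \in l' -> False.
  by move=> /lJ Ji /lK Ki; have : (J `&` K) i by []; rewrite JK.
(* As [l] and [l'] are disjoint, one choice of events serves both lists. Mutual independence is then
   used three times: on [l ++ l'], on [l] and on [l']. *)
pose B i := if i \in l then A i else A' i.
have EB : E = \big[setI/setT]_(i <- l) B i.
  by rewrite EE; apply: eq_big_seq => i il; rewrite /B il.
have EB' : E' = \big[setI/setT]_(i <- l') B i.
  rewrite EE'; apply: eq_big_seq => i il; rewrite /B; case: ifPn => // il'.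
  by case: (ll' i).
have FB i : i \in l ++ l' -> F i (B i).
  by rewrite mem_cat /B; case: ifPn => [/lA//|_ /= /lA'].
have FBl i : i \in l -> F i (B i) by move=> il; apply: FB; rewrite mem_cat il.
have FBl' i : i \in l' -> F i (B i) by move=> il; apply: FB; rewrite mem_cat il orbT.
have ucat : uniq (l ++ l').
  rewrite cat_uniq ul ul' andbT /=; apply/hasPn => i il'; apply/negP => il.
  exact: ll' il il'.
have := Findep ucat FB; rewrite !big_cat /= -EB -EB'.
rewrite -(Findep ul FBl) -(Findep ul' FBl') -EB -EB' => PEE'.
have mEE' := measurableI _ _ mE mE'.
by rewrite -[LHS]fineK ?fin_num_measure// PEE' EFinM !fineK ?fin_num_measure.
Qed.

End MutualIndependence.

(** * First moments of Gaussian vectors *)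

Section CenteredGaussian.
Context {R : realType}.

(* [|y| / s <= 1 + y^2 / (4 s^2) <= exp (3 y^2 / (8 s^2))]: the factor [|y|] is
   absorbed by doubling the standard deviation. *)
Lemma abs_mul_normal_pdf_le (s y : R) : 0 < s ->
  `|y| * normal_pdf 0 s y <=
  s * normal_peak s / normal_peak (2 * s) * normal_pdf 0 (2 * s) y.
Proof.
move=> s0; have s20 : 0 < 2 * s by rewrite mulr_gt0.
rewrite !normal_pdfE ?gt_eqF// /normal_fun !subr0.
pose a := y ^+ 2 / (s ^+ 2 *+ 2).
have -> : - y ^+ 2 / (s ^+ 2 *+ 2) = - a by rewrite mulNr.
(* Doubling the deviation divides the exponent by four, and [- a / 4] is [3 / 4 * a - a]; the factor
   [expR (3 / 4 * a)] is what must dominate [|y| / s]. *)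
have -> : - y ^+ 2 / ((2 * s) ^+ 2 *+ 2) = 3 / 4 * a + - a.
  by rewrite /a; field; rewrite gt_eqF.
have p0 := normal_peak_gt0 (lt0r_neq0 s0).
have p20 := normal_peak_gt0 (lt0r_neq0 s20).
rewrite expRD; set e := expR (3 / 4 * a); set e' := expR (- a).
have -> : s * normal_peak s / normal_peak (2 * s) * (normal_peak (2 * s) * (e * e')) =
    normal_peak s * (s * e * e').
  by field; rewrite gt_eqF.
rewrite mulrCA ler_pM2l// ler_pM2r ?expR_gt0//.
rewrite mulrC -ler_pdivrMr// (le_trans _ (expR_ge1Dx _))//.
rewrite /a -(real_normK (num_real y)); set z := `|y|.
rewrite -subr_ge0.
(* Completing the square in [z / s], the quadratic being [1 - r + 3 / 8 * r ^+ 2] with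
   [r = z / s]. *)
have -> : 1 + 3 / 4 * (z ^+ 2 / (s ^+ 2 *+ 2)) - z / s =
  (1 - z / s / 2) ^+ 2 + (z / s) ^+ 2 / 8.
  by field; rewrite gt_eqF.
by rewrite addr_ge0 ?sqr_ge0// divr_ge0 ?sqr_ge0.
Qed.

Local Open Scope ereal_scope.

(** The integral is moved to Lebesgue measure through the Radon-Nikodym density, which is almost
    everywhere the normal density. The pointwise bound then leaves a constant times a normal density
    of total mass one. *)
Lemma normal_prob_abs_lty (s : R) : (0 < s)%R ->
  \int[normal_prob 0 s]_y `|y|%:E < +oo.
Proof.
move=> s0; have dom := normal_prob_dominates 0 s.
have mabs : measurable_fun [set: R] (fun y => `|y|%:E : \bar R).
  by apply/measurable_EFinP; exact: normr_measurable.
rewrite -(Radon_Nikodym_SigmaFinite.change_of_variables dom)//.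
set rn := Radon_Nikodym_SigmaFinite.f _ _.
have intrn : lebesgue_measure.-integrable setT rn.
  exact: Radon_Nikodym_SigmaFinite.f_integrable.
have mpdf s' : measurable_fun [set: R] (fun y => (normal_pdf 0 s' y)%:E).
  by apply/measurable_EFinP; exact: measurable_normal_pdf.
have rn_pdf : ae_eq lebesgue_measure setT rn (fun y => (normal_pdf 0 s y)%:E).
  apply: integral_ae_eq => [//|//||E _ mE]; first exact: mpdf.
  by rewrite -Radon_Nikodym_SigmaFinite.f_integral.
pose f1 (y : R) := `|y|%:E * rn y.
pose f2 (y : R) := `|y|%:E * (normal_pdf 0 s y)%:E.
pose f3 (y : R) := (s * normal_peak s / normal_peak (2 * s))%:E *
  (normal_pdf 0 (2 * s) y)%:E.
have mf2 : measurable_fun setT f2 by apply: emeasurable_funM => //; exact: mpdf.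
have f20 y : 0 <= f2 y by rewrite /f2 -EFinM lee_fin mulr_ge0// normal_pdf_ge0.
have -> : \int[lebesgue_measure]_y f1 y = \int[lebesgue_measure]_y f2 y.
  apply: ge0_ae_eq_integral => //.
  - by apply: emeasurable_funM => //; exact: measurable_int intrn.
  - by move=> y _; rewrite mule_ge0 ?lee_fin// Radon_Nikodym_SigmaFinite.f_ge0.
  - exact: ae_eqe_mul2l.
apply: (@le_lt_trans _ _ (\int[lebesgue_measure]_y f3 y)).
  apply: ge0_le_integral => //.
  - by apply: emeasurable_funM => //; exact: mpdf.
  - by move=> y _; rewrite /f2 /f3 -!EFinM lee_fin abs_mul_normal_pdf_le.
rewrite integralZl//; last exact: integrable_normal_pdf.
by rewrite integral_normal_pdf mule1 ltry.
Qed.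

Context {d : measure_display} {Omega : measurableType d}.
Variable P : probability Omega R.

Lemma gaussian_integrable n (X : Omega -> 'cV[R]_n) (S : 'M[R]_n) i :
  psd S -> centered_gaussian P X S -> P.-integrable setT (EFin \o entry X i).
Proof.
move=> [_ S0] [mX gX]; have mXi := mX i.
apply/integrableP; split; first exact/measurable_EFinP.
(* The basis vector that makes the linear form [a^T *m X] the coordinate [i], whose law is thus
   given by the Gaussian hypothesis. *)
pose a : 'cV[R]_n := delta_mx i ord0.
have aX w : (a^T *m X w) ord0 ord0 = entry X i w.
  by rewrite /a trmx_delta -rowE mxE.
have mXi' : measurable_fun setT (entry X i : Omega -> measurableTypeR R) by exact: mXi.
have mabs : measurable_fun [set: measurableTypeR R] (fun y => `|y : R|%:E : \bar R).
  by apply/measurable_EFinP; exact: normr_measurable.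
pose X' : {mfun Omega >-> measurableTypeR R} :=
  HB.pack (entry X i : Omega -> measurableTypeR R)
    (isMeasurableFun.Build _ _ _ _ _ mXi').
have law E : measurable E -> distribution P X' E =
    if quad_form S a == 0%R then dirac (0%R : measurableTypeR R) E
    else normal_prob 0 (Num.sqrt (quad_form S a)) E.
  move=> mE; rewrite -(gX a E mE); congr (P _); apply/seteqP.
  by split => w /=; rewrite aX.
rewrite (_ : \int[P]_x _ = \int[distribution P X']_y `|y|%:E); last first.
  by rewrite ge0_integral_distribution.
case: (eqVneq (quad_form S a) 0%R) law => [_|nz] law.
  have -> : \int[distribution P X']_y `|y|%:E =
      \int[dirac (0%R : measurableTypeR R)]_y `|y : R|%:E.
    by apply: eq_measure_integral => E mE _; exact: law.
  by rewrite integral_dirac// diracT normr0 mule0 ltry.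
set sd := Num.sqrt _ in law.
have -> : \int[distribution P X']_y `|y|%:E = \int[normal_prob 0 sd]_y `|y|%:E.
  by apply: eq_measure_integral => E mE _; exact: law.
by apply: normal_prob_abs_lty; rewrite sqrtr_gt0 lt0r nz S0.
Qed.

(** By symmetry: [quad_form S] takes the same value at [a] and [- a], so the coordinate and its
    opposite have the same law, and the finite mean equals its own opposite. *)
Lemma gaussian_mean0 n (X : Omega -> 'cV[R]_n) (S : 'M[R]_n) i :
  psd S -> centered_gaussian P X S -> \int[P]_w (entry X i w)%:E = 0.
Proof.
move=> psdS gaussX; have intX := gaussian_integrable i psdS gaussX.
case: gaussX => mX gX; have mXi := mX i.
pose a : 'cV[R]_n := delta_mx i ord0.
have aX w : (a^T *m X w) ord0 ord0 = entry X i w.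
  by rewrite /a trmx_delta -rowE mxE.
have trN : (- a)^T = (- a^T)%R by apply/matrixP => ? ?; rewrite !mxE.
have naX w : ((- a)^T *m X w) ord0 ord0 = (- entry X i w)%R.
  by rewrite trN mulNmx mxE aX.
pose Y : Omega -> R := (fun w => - entry X i w)%R.
have mY : measurable_fun setT Y by exact: measurable_funN.
pose X' : {mfun Omega >-> R} := HB.pack (entry X i)
  (isMeasurableFun.Build _ _ _ _ _ mXi).
pose Y' : {mfun Omega >-> R} := HB.pack Y (isMeasurableFun.Build _ _ _ _ _ mY).
have XY : \int[P]_w (entry X i w)%:E = \int[P]_w (Y w)%:E.
  have intY : P.-integrable setT (EFin \o Y) by exact: integrableN intX.
  have intE (Z : {mfun Omega >-> R}) : P.-integrable setT (EFin \o Z) ->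
      \int[P]_w (Z w)%:E = \int[distribution P Z]_y y%:E.
    by move=> intZ; rewrite integral_distribution.
  rewrite (intE X')// (intE Y')//.
  apply: eq_measure_integral => E mE _.
  transitivity (P [set w | E ((a^T *m X w) ord0 ord0)]).
    by congr (P _); apply/seteqP; split => w /=; rewrite aX.
  transitivity (P [set w | E (((- a)^T *m X w) ord0 ord0)]).
    have quadN : quad_form S (- a) = quad_form S a.
      by rewrite /quad_form trN mulmxN !mulNmx opprK.
    by rewrite [LHS](gX a E mE) [RHS](gX (- a)%R E mE) quadN.
  by congr (P _); apply/seteqP; split => w /=; rewrite naX.
have fX : \int[P]_w (entry X i w)%:E \is a fin_num by exact: integrable_fin_num.
have := XY; rewrite /Y; under [RHS]eq_integral do rewrite EFinN.
rewrite integralN/=; last exact: integrable_add_def.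
rewrite -{1 2}(fineK fX) -EFinN => -[] /eqP.
by rewrite -addr_eq0 -mulr2n mulrn_eq0/= => /eqP f0; rewrite -(fineK fX) f0.
Qed.

End CenteredGaussian.

(** * The networked control system *)

Section NetworkedSystem.
Context {R : realType} {disp : measure_display} {Omega : measurableType disp}.
Variable P : probability Omega R.
Variables (n m q : nat) (A : 'M[R]_n) (B : 'M[R]_(n, m)) (C : 'M[R]_(q, n)).
Variables (x : nat -> Omega -> 'cV[R]_n) (y : nat -> Omega -> 'cV[R]_q)
  (u : nat -> Omega -> 'cV[R]_m) (wn : nat -> Omega -> 'cV[R]_n)
  (vn : nat -> Omega -> 'cV[R]_q) (s nu : nat -> Omega -> bool)
  (xhat xtilde : nat -> Omega -> 'cV[R]_n).

(* The induction is run with respect to the data enlarged by all control-channel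
   dropouts: this sigma-algebra contains the controls of time [t], which the data
   of the estimator at time [t] do not determine. *)
Definition full_info (t : nat) : set (set Omega) :=
  estimator_info s y xhat u t `|` \bigcup_i sigma_of (nu i).

Hypothesis u_info : forall t, sigma_vec (u t) `<=` <<s full_info t >>.
Hypothesis state_eq : forall t w, x t.+1 w = A *m x t w + B *m u t w + wn t w.
Hypothesis output_eq : forall t w, y t w = C *m x t w + vn t w.
Hypothesis independence : mutually_independent P (source_sigma (x 0%N) wn vn s nu).
Hypothesis random_x0 : random_vector (x 0%N).
Hypothesis random_wn : forall t, random_vector (wn t).
Hypothesis random_vn : forall t, random_vector (vn t).
Hypothesis random_s : forall t, measurable_fun setT (s t).
Hypothesis random_nu : forall t, measurable_fun setT (nu t).
Hypothesis x0_int : forall i, P.-integrable setT (EFin \o entry (x 0%N) i).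
Hypothesis wn_int : forall t i, P.-integrable setT (EFin \o entry (wn t) i).
Hypothesis x0_mean : forall i, (\int[P]_w (entry (x 0%N) i w)%:E = 0)%E.
Hypothesis wn_mean : forall t i, (\int[P]_w (entry (wn t) i w)%:E = 0)%E.
Hypothesis xhat_def : forall t, is_cond_exp P (sensor_info y u t) (x t) (xhat t).
Hypothesis xtilde_def : forall t,
  is_cond_exp P (estimator_info s y xhat u t) (x t) (xtilde t).

(** * Sources of randomness and the control-free decomposition *)

Let src := source_sigma (x 0%N) wn vn s nu.
Definition src_gen (J : set source) : set (set Omega) := \bigcup_(i in J) src i.

Definition noise_sources : set source := [set i |
  match i with SensorDropout _ | ControlDropout _ => False | _ => True end].
Definition dropout_sources : set source := [set i |
  match i with SensorDropout _ | ControlDropout _ => True | _ => False end].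
(** These sources determine the data before time [t] and leave out [s t] and the noise entering
    [x t]: [ProcessNoise k] first acts on the state at [k.+1], and at time 0 the initial state
    itself plays the role of this noise. All control dropouts are included since [full_info]
    contains them. *)
Definition past_sources (t : nat) : set source := [set i |
  match i with
  | InitialState => 0 < t
  | ProcessNoise k => k.+1 < t
  | MeasurementNoise k | SensorDropout k => k < t
  | ControlDropout _ => true
  end%N].

Definition forced (t : nat) (w : Omega) := trajectory A B 0 (u ^~ w) t.
Definition free (t : nat) (w : Omega) := trajectory A 1%:M (x 0%N w) (wn ^~ w) t.
Definition free_output (t : nat) (w : Omega) := C *m free t w + vn t w.

Lemma state_split t w : x t w = free t w + forced t w.
Proof.
rewrite /free /forced; elim: t => [|t IHt] /=; first by rewrite addr0.
by rewrite state_eq IHt mulmxDr mul1mx [RHS]addrAC [in RHS]addrA.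
Qed.

Lemma output_split t w : y t w = free_output t w + C *m forced t w.
Proof. by rewrite output_eq state_split mulmxDr /free_output addrAC. Qed.

Lemma adapted_trajectory (G : set (set Omega)) k (M : 'M[R]_(n, k))
    (z : Omega -> 'cV[R]_n) (v : nat -> Omega -> 'cV[R]_k) t :
  (forall i, adapted G (entry z i)) ->
  (forall j, (j < t)%N -> forall i, adapted G (entry (v j) i)) ->
  forall i, adapted G (entry (fun w => trajectory A M (z w) (v ^~ w) t) i).
Proof.
move=> Gz; elim: t => [|t IHt] Gv /=; first exact: Gz.
apply: adapted_entryD => i; apply: adapted_mulmx => j.
  by apply: IHt => k' k't; apply: Gv; exact: ltnW.
exact: Gv.
Qed.

Lemma src_sigma i : sigma_algebra setT (src i).
Proof.
case: i => *; rewrite /= ?/sigma_vec; try exact: smallest_sigma_algebra;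
  by apply: sigma_algebra_preimage; exact: sigma_algebra_measurable.
Qed.

Lemma src_measurable i : src i `<=` measurable.
Proof.
have vec k (X : Omega -> 'cV[R]_k) : random_vector X -> sigma_vec X `<=` measurable.
  move=> mX; apply: sub_gen_measurable.
  apply: (big_ind (fun S => S `<=` measurable)) => //.
    by move=> S T Sm Tm E [/Sm|/Tm].
  by move=> i0 _ _ [D mD <-]; exact: mX.
have boolean (X : Omega -> bool) : measurable_fun setT X -> sigma_of X `<=` measurable.
  by move=> mX _ [D mD <-]; exact: mX.
by case: i => [|t|t|t|t] /=;
  [exact: vec|exact: vec|exact: vec|exact: boolean|exact: boolean].
Qed.

Lemma src_gen_measurable J : src_gen J `<=` measurable.
Proof. by move=> E [i _ /src_measurable]. Qed.

Lemma src_gen_sub J i : J i -> src i `<=` <<s src_gen J >>.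
Proof. by move=> Ji E srcE; apply: sub_sigma_algebra; exists i. Qed.

Lemma indep_src J K : J `&` K = set0 -> indep P <<s src_gen J >> <<s src_gen K >>.
Proof.
by move=> JK; apply: indep_families => //; [exact: src_sigma|exact: src_measurable].
Qed.

Lemma free_adapted J t :
  J InitialState -> (forall k, (k < t)%N -> J (ProcessNoise k)) ->
  forall i, adapted (src_gen J) (entry (free t) i).
Proof.
move=> J0 JP; apply: (@adapted_trajectory _ _ 1%:M (x 0%N) wn).
  by apply/sigma_vecP; exact: (@src_gen_sub J InitialState J0).
by move=> k kt; apply/sigma_vecP; exact: (@src_gen_sub J (ProcessNoise k) (JP k kt)).
Qed.

Lemma free_output_adapted J t :
  J InitialState -> (forall k, (k < t)%N -> J (ProcessNoise k)) ->
  J (MeasurementNoise t) ->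
  forall i, adapted (src_gen J) (entry (free_output t) i).
Proof.
move=> J0 JP JM; apply: adapted_entryD => i.
  by apply: adapted_mulmx; exact: free_adapted.
by move: i; apply/sigma_vecP; exact: (@src_gen_sub J (MeasurementNoise t) JM).
Qed.

Lemma full_info_mono t t' : (t <= t')%N -> full_info t `<=` full_info t'.
Proof.
move=> tt' E [FE|NE]; [left|by right]; move: E FE.
apply: sub_sigma_algebra2 => E [i /= it ME]; exists i => //=.
exact: leq_trans it _.
Qed.

Lemma adapted_forced (G : set (set Omega)) t :
  (forall k, (k < t)%N -> forall i, adapted G (entry (u k) i)) ->
  forall i, adapted G (entry (forced t) i).
Proof.
move=> Gu; apply: (@adapted_trajectory G _ B (fun=> 0) u) => // i.
rewrite /entry; under eq_fun do rewrite mxE.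
exact: adapted_cst.
Qed.

(** * Causality: data and controls as functions of control-free outputs and dropouts *)

Section CausalClosure.
Variables (G : set (set Omega)) (t : nat).
Hypothesis G_output :
  forall k, (k <= t)%N -> forall i, adapted G (entry (free_output k) i).
Hypothesis G_s : forall k, (k <= t)%N -> sigma_of (s k) `<=` <<s G >>.
Hypothesis G_nu : forall k, sigma_of (nu k) `<=` <<s G >>.

Let output_adapted k : (k <= t)%N ->
  (forall j, (j < k)%N -> forall i, adapted G (entry (u j) i)) ->
  forall i, adapted G (entry (y k) i).
Proof.
move=> kt Gu i.
have -> : y k = (fun w => free_output k w + C *m forced k w).
  by apply/funext => w; exact: output_split.
apply: adapted_entryD i => i; first exact: G_output.
by apply: adapted_mulmx; exact: adapted_forced.
Qed.

Let info_sub k : (k <= t)%N ->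
  (forall j, (j < k)%N -> forall i, adapted G (entry (u j) i)) ->
  full_info k `<=` <<s G >>.
Proof.
move=> kt Gu E [|[j _]]; last exact: G_nu.
apply: (sub_gen_sigma (G := \bigcup_(i in `I_k.+1) message s y xhat u i)).
move=> {}E [j]; rewrite /= ltnS => jk.
have jt : (j <= t)%N by exact: leq_trans jk kt.
have Guj l : (l < j)%N -> forall i, adapted G (entry (u l) i).
  by move=> lj; apply: Gu; exact: leq_trans lj jk.
have Gs : adapted G (fun w => (s j w)%:R : R) by exact: adapted_bool (G_s jt).
(* The sensor estimate at time [j] depends on outputs up to [j] and controls before [j], all adapted
   by the assumption on earlier controls. *)
have Gxhat : forall i, adapted G (entry (xhat j) i).
  apply/sigma_vecP; apply: subset_trans (proj1 (xhat_def j)) _.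
  apply: sub_gen_sigma => F [[l /= lj]|[l /= lj]]; move: F; apply/sigma_vecP.
    rewrite ltnS in lj; apply: output_adapted; first exact: leq_trans lj jt.
    by move=> l' l'l; apply: Guj; exact: leq_trans l'l lj.
  exact: Guj.
move=> [[[|]|]|]; move: E.
- by apply/sigma_vecP; apply: adapted_entryZ => //; exact: output_adapted.
- by apply/sigma_vecP; exact: adapted_entryZ.
- exact: G_s.
- apply/sigma_vecP; case: j jk {jt Gs Gxhat} Guj => [|j] jk Guj /=; last exact: Guj.
  by move=> i; rewrite /entry; under eq_fun do rewrite mxE; exact: adapted_cst.
Qed.

(* The feedback loop is resolved here: by causality the data, hence the
   controls, are functions of the control-free outputs and of the dropouts. *)
Lemma control_adapted k : (k <= t)%N -> forall i, adapted G (entry (u k) i).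
Proof.
elim/ltn_ind: k => k IHk kt; apply/sigma_vecP.
move=> E uE; apply: sub_gen_sigma (u_info uE); apply: info_sub => // j jk.
by apply: IHk => //; exact: leq_trans (ltnW jk) kt.
Qed.

Lemma full_info_sub : full_info t `<=` <<s G >>.
Proof. by apply: info_sub => // j /ltnW; exact: control_adapted. Qed.

Lemma closure_output_adapted k : (k <= t)%N -> forall i, adapted G (entry (y k) i).
Proof.
move=> kt; apply: output_adapted => // j jk.
by apply: control_adapted; exact: leq_trans (ltnW jk) kt.
Qed.

End CausalClosure.

(** The control-free outputs up to time [t] involve process noise only up to [t - 1], so [wn t]
    stays out; this later gives its independence from the data of time [t]. *)
Lemma full_info_past t : full_info t `<=` <<s src_gen (past_sources t.+1) >>.
Proof.
apply: full_info_sub => [k kt|k kt|k].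
- apply: free_output_adapted => //= j jk; exact: leq_trans jk kt.
- exact: (@src_gen_sub _ (SensorDropout k)).
- exact: (@src_gen_sub _ (ControlDropout k)).
Qed.

Lemma full_info_measurable t : full_info t `<=` measurable.
Proof.
move=> E /full_info_past.
exact: (sub_gen_measurable (@src_gen_measurable _)).
Qed.

(** * The sensor estimate, conditionally on all dropouts *)

Definition free_info (t : nat) : set (set Omega) :=
  \bigcup_(k in `I_t.+1) sigma_vec (free_output k).

Let free_dropout (t : nat) : set (set Omega) :=
  <<s free_info t >> `|` <<s src_gen dropout_sources >>.

Let free_dropout_output t k : (k <= t)%N ->
  forall i, adapted (free_dropout t) (entry (free_output k) i).
Proof.
move=> kt; apply/sigma_vecP => E yE; apply: sub_sigma_algebra; left.
by apply: sub_sigma_algebra; exists k.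
Qed.

Let free_dropout_s t k : (k <= t)%N -> sigma_of (s k) `<=` <<s free_dropout t >>.
Proof.
move=> _ E sE; apply: sub_sigma_algebra; right.
exact: (@src_gen_sub _ (SensorDropout k)).
Qed.

Let free_dropout_nu t : forall k, sigma_of (nu k) `<=` <<s free_dropout t >>.
Proof.
move=> k E nuE; apply: sub_sigma_algebra; right.
exact: (@src_gen_sub _ (ControlDropout k)).
Qed.

Let full_info_free t : full_info t `<=` <<s free_dropout t >>.
Proof.
by apply: full_info_sub => k; [exact: free_dropout_output|exact: free_dropout_s|
  exact: free_dropout_nu].
Qed.

Let sensor_info_free t : sensor_info y u t `<=` <<s free_dropout t >>.
Proof.
apply: sub_gen_sigma => E [[k /= kt]|[k /= kt]]; move: E; apply/sigma_vecP.
  exact: (closure_output_adapted (@free_dropout_output t) (@free_dropout_s t)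
    (@free_dropout_nu t) kt).
exact: (control_adapted (@free_dropout_output t) (@free_dropout_s t)
  (@free_dropout_nu t) (ltnW kt)).
Qed.

Lemma free_info_noise t : free_info t `<=` <<s src_gen noise_sources >>.
Proof. by move=> E [k _]; move: E; apply/sigma_vecP; exact: free_output_adapted. Qed.

(** The sensor knows the applied controls, hence can subtract their contribution from the
    outputs. *)
Lemma free_info_sensor t : free_info t `<=` sensor_info y u t.
Proof.
move=> E [k /= kt]; move: E; apply/sigma_vecP => i.
have -> : free_output k = (fun w => y k w + (- C) *m forced k w).
  by apply/funext => w; rewrite output_split mulNmx addrK.
apply: adapted_entryD i => [|i].
  by apply/sigma_vecP => E yE; apply: sub_sigma_algebra; left; exists k.
apply: adapted_mulmx => j; apply: adapted_forced => l lk.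
apply/sigma_vecP => E uE; apply: sub_sigma_algebra; right; exists l => //=.
exact: leq_trans lk kt.
Qed.


Lemma x_int t i : P.-integrable setT (EFin \o entry (x t) i).
Proof. by have [_ /(_ i)[]] := xhat_def t. Qed.

Lemma xhat_int t i : P.-integrable setT (EFin \o entry (xhat t) i).
Proof. by have [_ /(_ i)[]] := xhat_def t. Qed.

Lemma xtilde_int t i : P.-integrable setT (EFin \o entry (xtilde t) i).
Proof. by have [_ /(_ i)[]] := xtilde_def t. Qed.

Lemma free_int t : forall i, P.-integrable setT (EFin \o entry (free t) i).
Proof.
rewrite /free; elim: t => [|t IHt] /= i; first exact: x0_int.
by apply: integrable_entryD; exact: integrable_mulmx.
Qed.

(** Integrability is inherited from [x t], for which it is part of [xhat_def], and from the free
    part. *)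
Lemma forced_int t i : P.-integrable setT (EFin \o entry (forced t) i).
Proof.
have -> : forced t = (fun w => x t w - free t w).
  by apply/funext => w; rewrite state_split addrAC subrr add0r.
by apply: integrable_entryB; [exact: x_int|exact: free_int].
Qed.

Lemma free_info_measurable t : free_info t `<=` measurable.
Proof.
move=> E /free_info_noise.
exact: (sub_gen_measurable (@src_gen_measurable _)).
Qed.

Let free_dropout_measurable t : free_dropout t `<=` measurable.
Proof.
move=> E []; apply: sub_gen_measurable; first exact: free_info_measurable.
exact: src_gen_measurable.
Qed.

Lemma sensor_info_measurable t : sensor_info y u t `<=` measurable.
Proof.
move=> E /sensor_info_free; exact: (sub_gen_measurable (@free_dropout_measurable t)).
Qed.

(** On an intersection of a control-free output event [E] and a dropout event [F], the integral
    factors as [P F] times the integral over [E], which is zero by the choice of [g]. Such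
    intersections suffice by [null_onU]. *)
Let free_dropout_null t i (g : Omega -> R) :
  adapted (free_info t) g -> P.-integrable setT (EFin \o g) ->
  (forall E, <<s free_info t >> E ->
     \int[P]_(w in E) (g w)%:E = \int[P]_(w in E) (entry (free t) i w)%:E)%E ->
  null_on P <<s free_dropout t >> (fun w => entry (free t) i w - g w).
Proof.
move=> Gg intg gE; have intf := free_int t i.
have fm := sub_gen_measurable (@free_info_measurable t).
have inth : P.-integrable setT (EFin \o (fun w => entry (free t) i w - g w)).
  rewrite (_ : _ \o _ = (EFin \o entry (free t) i) \- (EFin \o g))%E//.
  exact: integrableB.
apply: null_onU => //.
- exact: (sub_gen_measurable (@src_gen_measurable _)).
- exact: gen_sigma_setI.
- exact: gen_sigma_setI.
- exact: gen_sigma_setT.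
- exact: gen_sigma_setT.
move=> E F GE DF.
have disj : noise_sources `&` dropout_sources = set0.
  by apply/seteqP; split => // -[|k|k|k|k] [].
rewrite (integral_indep (G := src_gen noise_sources))//.
- have null : null_on P <<s free_info t >> (fun w => entry (free t) i w - g w).
    by apply/null_onB.
  by rewrite [X in (_ * X)%E](null E GE) mule0.
- exact: src_gen_measurable.
- exact: (sub_gen_measurable (@src_gen_measurable _) DF).
- by move=> F' GF'; exact: (indep_src disj).
- apply: adaptedB; first exact: free_adapted.
  by apply: adapted_sub Gg; exact: free_info_noise.
- exact: (sub_gen_sigma (@free_info_noise t)).
Qed.

(* [E[free t | free_info t] + forced t] is a version of [E[x t | sensor_info]]
   whose error stays null on events that also involve the dropouts, since these
   are independent of [free t] and [free_info t]. *)
Lemma xhat_null t i :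
  null_on P <<s full_info t >> (fun w => entry (x t) i w - entry (xhat t) i w).
Proof.
have [g [Gg intg gE]] := cond_exp_exists (@free_info_measurable t) (free_int t i).
pose z w := g w + entry (forced t) i w.
have intz : P.-integrable setT (EFin \o z).
  rewrite (_ : _ \o _ = (EFin \o g) \+ (EFin \o entry (forced t) i))%E//.
  by apply: integrableD => //; exact: forced_int.
have Jm := sub_gen_measurable (@free_dropout_measurable t).
have zx E : <<s free_dropout t >> E ->
    (\int[P]_(w in E) (z w)%:E = \int[P]_(w in E) (entry (x t) i w)%:E)%E.
  move: E; apply/null_onB => //; first exact: x_int.
  rewrite (_ : (fun w => _) = (fun w => entry (free t) i w - g w)).
    exact: free_dropout_null.
  by apply/funext => w; rewrite /z /entry state_split !mxE opprD addrACA subrr addr0.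
have fdE E : <<s full_info t >> E -> <<s free_dropout t >> E.
  exact: (sub_gen_sigma (@full_info_free t)).
(* Both are sensor-measurable and integrate like [x t] over sensor events, those being among the
   events treated by [zx]. *)
have zhat : {ae P, forall w, z w = entry (xhat t) i w}.
  apply: (cond_exp_unique (@sensor_info_measurable t)) => //.
  - apply: adaptedD.
      apply: adapted_sub Gg => E /free_info_sensor; exact: sub_sigma_algebra.
    apply: adapted_forced => k kt; apply/sigma_vecP => E uE.
    by apply: sub_sigma_algebra; apply: sub_sigma_algebra; right; exists k.
  - move: i {intz zx z Gg intg gE g}; apply/sigma_vecP.
    by move=> E /(proj1 (xhat_def t)); exact: sub_sigma_algebra.
  - exact: xhat_int.
  - move=> E; rewrite gen_sigmaK => sE; rewrite zx; last exact: sensor_info_free.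
    by have [_ /(_ i)[_ _ ->]] := xhat_def t.
apply/null_onB; [exact: subset_trans (sub_gen_measurable (@full_info_measurable t)) _
  |exact: x_int|exact: xhat_int|].
move=> E fE; rewrite -zx; last exact: fdE.
have mE := Jm _ (fdE _ fE).
apply: ae_eq_integral => //.
- apply: measurable_funTS; exact: measurable_int (xhat_int t i).
- apply: measurable_funTS; exact: measurable_int intz.
- by case: zhat => N [mN PN sN]; exists N; split => // w /= H; apply: sN => /= zw;
    apply: H => _; rewrite zw.
Qed.

(** * Prediction when the packet is lost *)

Definition prev_info (t : nat) : set (set Omega) :=
  if t is k.+1 then full_info k else \bigcup_i sigma_of (nu i).

Definition loss (t : nat) : set Omega := s t @^-1` [set false].

Lemma prev_info_past t : prev_info t `<=` <<s src_gen (past_sources t) >>.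
Proof.
case: t => [|t] /=; last exact: full_info_past.
by move=> E [i _ nuE]; apply: sub_sigma_algebra; exists (ControlDropout i).
Qed.

Lemma nu_prev_info t i : sigma_of (nu i) `<=` <<s prev_info t >>.
Proof.
move=> E nuE; apply: sub_sigma_algebra.
by case: t => [|t]; [exists i|right; exists i].
Qed.

(** On [loss t] the two transmitted products vanish and [s t] is constant. The last control is
    measurable with respect to [prev_info t] by [u_info], or zero at time 0, and older messages
    already belong to [prev_info t]. Control dropouts lie in [prev_info t] at every time, including
    0. *)
Lemma full_info_trace t E : <<s full_info t >> E ->
  exists2 E', <<s prev_info t >> E' & E `&` loss t = E' `&` loss t.
Proof.
have sub (F : set Omega) : <<s prev_info t >> F ->
  exists2 E', <<s prev_info t >> E' & F `&` loss t = E' `&` loss t by exists F.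
move: E; apply: gen_sigma_trace => E [|[i _ nuE]]; last first.
  by apply: sub; exact: nu_prev_info nuE.
move: E; apply: gen_sigma_trace => E [k /= ]; rewrite ltnS leq_eqVlt => /predU1P[->|kt].
  move=> [[[|]|]|]; move: E.
  - by apply: trace_sigma_vec_cst => w; rewrite /loss/= => ->; rewrite scale0r.
  - by apply: trace_sigma_vec_cst => w; rewrite /loss/= => ->; rewrite scale0r.
  - by move=> _ [S _ <-]; rewrite setTI; exact: (@trace_preimage_cst _ _ _ _ _ _ false).
  - case: t sub => [|t'] sub /=; first exact: trace_sigma_vec_cst.
    by move=> E /u_info; exact: sub.
move=> kE; apply: sub; case: t kt => // t' kt; apply: sub_sigma_algebra; left.
by apply: sub_sigma_algebra; exists k.
Qed.

(** Taking the initial state as the innovation of time 0 makes the state equation hold there too,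
    with zero delayed state and control. *)
Definition innovation (t : nat) : Omega -> 'cV[R]_n := if t is k.+1 then wn k else x 0%N.

Let innovation_source (t : nat) : source :=
  if t is k.+1 then ProcessNoise k else InitialState.

Definition error (t : nat) (w : Omega) : 'cV[R]_n := x t w - xtilde t w.

Lemma state_innovation t w :
  x t w = A *m delayed x t w + B *m delayed u t w + innovation t w.
Proof. by case: t => [|t] /=; [rewrite !mulmx0 !add0r|exact: state_eq]. Qed.

Lemma innovation_int t i : P.-integrable setT (EFin \o entry (innovation t) i).
Proof. by case: t => [|t]; [exact: x0_int|exact: wn_int]. Qed.

Lemma delayed_error_int t i : P.-integrable setT (EFin \o entry (delayed error t) i).
Proof.
case: t => [|t] /=; first exact: entry0_int.
by apply: integrable_entryB; [exact: x_int|exact: xtilde_int].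
Qed.

Lemma delayed_error_adapted t i :
  adapted (src_gen (past_sources t)) (entry (delayed error t) i).
Proof.
case: t => [|t] /=.
  by rewrite /entry; under eq_fun do rewrite mxE; exact: adapted_cst.
rewrite /error entryB; apply: adaptedB; last first.
  move: i; apply/sigma_vecP => E /(proj1 (xtilde_def t)) tE.
  by apply: full_info_past; left.
have -> : x t = (fun w => free t w + forced t w).
  by apply/funext => w; exact: state_split.
move: i; apply: adapted_entryD => i; first exact: free_adapted.
apply: adapted_forced => k kt; apply/sigma_vecP => E /u_info uE.
apply: sub_gen_sigma uE; apply: subset_trans (full_info_mono (ltnW kt)) _.
exact: full_info_past.
Qed.

Lemma s_loss t : sigma_of (s t) (loss t).
Proof. by exists [set false] => //; rewrite setTI. Qed.

Lemma loss_measurable t : measurable (loss t).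
Proof. by apply: (@src_measurable (SensorDropout t)); exact: s_loss. Qed.

(** The delayed error and [E] depend on past sources, hence are independent of [loss t], which
    factors out and leaves a null integral. The innovation is centered and independent of both [E]
    and [loss t]. *)
Lemma prediction_null t :
  (forall i, null_on P <<s prev_info t >> (entry (delayed error t) i)) ->
  forall E i, <<s prev_info t >> E ->
  (\int[P]_(w in E `&` loss t)
     (entry (fun w => A *m delayed error t w + innovation t w) i w)%:E = 0)%E.
Proof.
move=> IH E i pE.
have pm : prev_info t `<=` measurable.
  by move=> F /prev_info_past; exact: (sub_gen_measurable (@src_gen_measurable _)).
have mE := sub_gen_measurable pm pE.
have mEs := measurableI _ _ mE (loss_measurable t).
have intAe : P.-integrable setT (EFin \o entry (fun w => A *m delayed error t w) i).
  by apply: integrable_mulmx; exact: delayed_error_int.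
have pastE : <<s src_gen (past_sources t) >> E.
  exact: sub_gen_sigma (@prev_info_past t) _ pE.
have disj1 : past_sources t `&` [set SensorDropout t] = set0.
  by apply/seteqP; split => // j [+ /= jE]; rewrite jE /= ltnn.
have disj2 : [set innovation_source t] `&`
    (past_sources t `|` [set SensorDropout t]) = set0.
  apply/seteqP; split => // j [/= ->].
  by case: t {IH pE pm mE mEs intAe pastE disj1} => [|t] []; rewrite //= ltnn.
have pastEs : <<s src_gen (past_sources t `|` [set SensorDropout t]) >> (E `&` loss t).
  apply: gen_sigma_setI.
    by apply: sub_sigma_algebra2 pastE => F [j pj jF]; exists j => //; left.
  by apply: sub_sigma_algebra; exists (SensorDropout t); [right|exact: s_loss].
transitivity (\int[P]_(w in E `&` loss t)
    (entry (fun w => A *m delayed error t w) i w)%:E +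
    \int[P]_(w in E `&` loss t) (entry (innovation t) i w)%:E)%E.
  rewrite -integralD//; last 2 first.
  - exact: integrableS intAe.
  - exact: integrableS (innovation_int t i).
  by apply: eq_integral => w _; rewrite /entry [in LHS]mxE EFinD.
rewrite (integral_indep (G := src_gen (past_sources t)))//; first last.
- by apply: adapted_mulmx; exact: delayed_error_adapted.
- move=> F pF; apply: (indep_src disj1) => //.
  by apply: sub_sigma_algebra; exists (SensorDropout t) => //; exact: s_loss.
- exact: loss_measurable.
- exact: src_gen_measurable.
have nullA := null_on_mulmx A (sub_gen_measurable pm) (delayed_error_int t) IH i.
rewrite [X in (_ * X)%E](nullA E pE) mule0 add0e.
(* Now all of [E] and [loss t] is the independent event and [setT] the event of the innovation, so
   the integral becomes a probability times the mean. *)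
rewrite -(setTI (E `&` loss t)).
rewrite (integral_indep (G := src_gen [set innovation_source t]))//; first last.
- exact: gen_sigma_setT.
- exact: innovation_int.
- move: i {intAe nullA}; apply/sigma_vecP => F eF; apply: sub_sigma_algebra.
  exists (innovation_source t) => //.
  by case: t {IH pE pm mE mEs pastE disj1 disj2 pastEs} eF.
- by move=> F eF; exact: (indep_src disj2).
- exact: src_gen_measurable.
suff -> : (\int[P]_w (entry (innovation t) i w)%:E = 0)%E by rewrite mule0.
move: i {intAe nullA}; case: t {IH pE pm mE mEs pastE disj1 disj2 pastEs} => [|t] i.
  exact: x0_mean.
exact: wn_mean.
Qed.

(** * The recursion and its induction *)

Definition update (t : nat) (w : Omega) : 'cV[R]_n :=
  (s t w)%:R *: xhat t w +
  (1 - (s t w)%:R) *: (A *m delayed xtilde t w + B *m delayed u t w).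

Lemma update_error t w : x t w - update t w = (s t w)%:R *: (x t w - xhat t w) +
  (1 - (s t w)%:R) *: (A *m delayed error t w + innovation t w).
Proof.
have -> : A *m delayed error t w + innovation t w =
    x t w - (A *m delayed xtilde t w + B *m delayed u t w).
  rewrite [x t w]state_innovation.
  have -> : delayed error t w = delayed x t w - delayed xtilde t w.
    by case: t => [|t] //=; rewrite subr0.
  by rewrite mulmxBr [RHS]addrAC opprD [in RHS]addrACA subrr addr0.
rewrite /update; case: (s t w) => /=.
  by rewrite subrr !scale0r !addr0 !scale1r.
by rewrite subr0 !scale0r !add0r !scale1r.
Qed.

Lemma s_real_measurable t : measurable_fun setT (fun w => (s t w)%:R : R).
Proof.
apply: (adapted_measurable (@src_gen_measurable [set SensorDropout t])).
by apply: adapted_bool => E sE; apply: sub_sigma_algebra; exists (SensorDropout t).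
Qed.

Lemma update_int t i : P.-integrable setT (EFin \o entry (update t) i).
Proof.
have ms := s_real_measurable t.
have delayed_int (X : nat -> Omega -> 'cV[R]_n) j :
    (forall k j, P.-integrable setT (EFin \o entry (X k) j)) ->
    P.-integrable setT (EFin \o entry (delayed X t) j).
  by move=> intX; case: t {i ms} => [|t] /=; [exact: entry0_int|exact: intX].
apply: integrable_entryD; apply: integrable_entryZ.
- exact: ms.
- by move=> w; case: (s t w); rewrite ?normr1 ?normr0.
- exact: xhat_int.
- exact: measurable_funB.
- by move=> w; case: (s t w); rewrite ?subrr ?subr0 ?normr1 ?normr0.
apply: integrable_entryD.
  by apply: integrable_mulmx => j; apply: delayed_int; exact: xtilde_int.
(* The control term is recovered from the state equation, so that its integrability follows from
   that of the states and the innovation. *)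
have -> : (fun w => B *m delayed u t w) =
    (fun w => (x t w - A *m delayed x t w) - innovation t w).
  apply/funext => w; rewrite [in RHS]state_innovation.
  by rewrite -addrA -opprD [X in _ = X - _]addrAC [RHS]addrAC subrr add0r.
apply: integrable_entryB; last exact: innovation_int.
apply: integrable_entryB; first exact: x_int.
by apply: integrable_mulmx => j; apply: delayed_int; exact: x_int.
Qed.

Lemma update_adapted t i : adapted (estimator_info s y xhat u t) (entry (update t) i).
Proof.
pose F := estimator_info s y xhat u t.
have Fmsg E : message s y xhat u t E -> <<s F >> E.
  by move=> tE; apply: sub_sigma_algebra; apply: sub_sigma_algebra; exists t => /=.
have Fs : adapted F (fun w => (s t w)%:R : R).
  by apply: adapted_bool => E sE; apply: Fmsg; left; right.
rewrite -/F; move: i; apply: adapted_entryD => i.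
  by move: i; apply/sigma_vecP => E sE; apply: Fmsg; left; left; right.
apply: adapted_entryZ => {i}[|i].
  by apply: adaptedB => //; exact: adapted_cst.
apply: adapted_entryD => {}i; apply: adapted_mulmx => j; last first.
  by move: j; apply/sigma_vecP => E uE; apply: Fmsg; right.
rewrite /F {F Fmsg Fs}; move: j; case: t => [|t] j /=.
  by rewrite /entry; under eq_fun do rewrite mxE; exact: adapted_cst.
move: j; apply/sigma_vecP => E /(proj1 (xtilde_def t)) tE.
apply: sub_sigma_algebra; move: E tE; apply: sub_sigma_algebra2 => E [k /= kt kE].
by exists k => //=; exact: ltnW.
Qed.

(* On [loss t] an event of [full_info t] is an event of [prev_info t], which is
   independent of [s t] and of the innovation; off [loss t], [xhat_null] applies. *)
Lemma update_error_null t :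
  (forall i, null_on P <<s prev_info t >> (entry (delayed error t) i)) ->
  forall i, null_on P <<s full_info t >> (entry (fun w => x t w - update t w) i).
Proof.
move=> IH i E fE.
have mE := sub_gen_measurable (@full_info_measurable t) fE.
have mloss := loss_measurable t.
have intX : P.-integrable setT (EFin \o entry (fun w => x t w - update t w) i).
  by apply: integrable_entryB; [exact: x_int|exact: update_int].
have fEs : <<s full_info t >> (E `\` loss t).
  rewrite setDE; apply: gen_sigma_setI => //.
  apply: sigma_algebraC; apply: sub_sigma_algebra; left; apply: sub_sigma_algebra.
  by exists t => //=; left; right; exact: s_loss.
rewrite -(setUIDK E (loss t)) integral_setU//; last 4 first.
- exact: measurableI.
- exact: measurableD.
- by apply: measurable_funTS; exact: measurable_int intX.
- by apply/disj_setPS => w [[_ ?] [_ ?]].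
have [E' pE' EE'] := full_info_trace fE.
rewrite EE'.
transitivity (\int[P]_(w in E' `&` loss t)
    (entry (fun w => A *m delayed error t w + innovation t w) i w)%:E +
  \int[P]_(w in E `\` loss t) (entry (x t) i w - entry (xhat t) i w)%:E)%E.
  congr (_ + _)%E; apply: eq_integral => w; rewrite inE => -[_].
    rewrite /loss/= /entry => swF.
    by rewrite update_error swF scale0r add0r subr0 scale1r.
  rewrite /loss/= /entry => /eqP; rewrite eqbF_neg negbK => swT.
  by rewrite update_error swT subrr scale0r addr0 scale1r !mxE.
by rewrite prediction_null// add0e; exact: xhat_null.
Qed.

(** The update is measurable for the estimator and its error is null on the larger [full_info t], so
    uniqueness on [estimator_info] identifies it with [xtilde t]. The almost sure equality carries
    nullity on [full_info t] over to the error of [xtilde t], which is the hypothesis needed at the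
    next time. *)
Lemma xtilde_update t :
  (forall i, null_on P <<s prev_info t >> (entry (delayed error t) i)) ->
  {ae P, forall w, xtilde t w = update t w} /\
  (forall i, null_on P <<s full_info t >> (entry (error t) i)).
Proof.
move=> IH.
have Fm : estimator_info s y xhat u t `<=` measurable.
  by move=> E FE; apply: (@full_info_measurable t); left.
have updE i E : <<s full_info t >> E ->
    (\int[P]_(w in E) (entry (update t) i w)%:E =
     \int[P]_(w in E) (entry (x t) i w)%:E)%E.
  move: E; apply/null_onB.
  - exact: (sub_gen_measurable (@full_info_measurable t)).
  - exact: x_int.
  - exact: update_int.
  - by rewrite -entryB; exact: update_error_null.
have aei i : {ae P, forall w, entry (xtilde t) i w = entry (update t) i w}.
  apply: (cond_exp_unique Fm).
  - move: i; apply/sigma_vecP => E /(proj1 (xtilde_def t)); exact: sub_sigma_algebra.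
  - exact: update_adapted.
  - exact: xtilde_int.
  - exact: update_int.
  - move=> E; rewrite gen_sigmaK => FE.
    rewrite updE; last by apply: sub_sigma_algebra; left.
    by have [_ /(_ i)[_ _ ->]] := xtilde_def t.
split.
  have : {ae P, forall w, forall i, entry (xtilde t) i w = entry (update t) i w}.
    exact: filter_forall aei.
  by apply: filterS => w eqi; apply/colP => i; exact: eqi.
move=> i; rewrite /error entryB; apply/null_onB.
- exact: (sub_gen_measurable (@full_info_measurable t)).
- exact: x_int.
- exact: xtilde_int.
move=> E fE; rewrite -updE//.
have mE := sub_gen_measurable (@full_info_measurable t) fE.
apply: ae_eq_integral => //.
- by apply: measurable_funTS; exact: measurable_int (xtilde_int t i).
- by apply: measurable_funTS; exact: measurable_int (update_int t i).
- by apply: filterS (aei i) => w eqw _ /=; rewrite eqw.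
Qed.

Lemma error_null t : forall i, null_on P <<s prev_info t >> (entry (delayed error t) i).
Proof.
(* The step uses that [prev_info t.+1] is [full_info t]; at the start the delayed error is
   identically zero. *)
elim: t => [|t IHt] i; last by have [_] := xtilde_update IHt.
by move=> E _; apply: integral0_eq => w _; rewrite /entry mxE.
Qed.

Lemma xtilde_recursion t : {ae P, forall w, xtilde t w = update t w}.
Proof. by have [] := xtilde_update (@error_null t). Qed.

End NetworkedSystem.

Theorem lemma3
  (R : realType) (disp : measure_display) (Omega : measurableType disp)
  (P : probability Omega R)
  (d m q : nat)
  (A : 'M[R]_d) (B : 'M[R]_(d, m)) (C : 'M[R]_(q, d))
  (Sigma_x0 Sigma_w Sigma_w_half : 'M[R]_d) (Sigma_v : 'M[R]_q)
  (p_s p_c : R)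
  (x : nat -> Omega -> 'cV[R]_d) (y : nat -> Omega -> 'cV[R]_q)
  (u : nat -> Omega -> 'cV[R]_m)
  (wn : nat -> Omega -> 'cV[R]_d) (vn : nat -> Omega -> 'cV[R]_q)
  (s nu : nat -> Omega -> bool)
  (dispU : measure_display) (U : measurableType dispU)
  (cmd : nat -> Omega -> U)
  (xhat xtilde : nat -> Omega -> 'cV[R]_d)
  (stabilizable_AB : stabilizable A B)
  (observable_AC : observable A C)
  (psd_Sigma_w_half : psd Sigma_w_half)
  (Sigma_w_halfE : Sigma_w_half *m Sigma_w_half = Sigma_w)
  (controllable_AW : controllable A Sigma_w_half)
  (stable_A : marginally_stable A)
  (psd_Sigma_x0 : psd Sigma_x0) (psd_Sigma_w : psd Sigma_w)
  (posdef_Sigma_v : posdef Sigma_v)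
  (gauss_x0 : centered_gaussian P (x 0%N) Sigma_x0)
  (gauss_w : forall t, centered_gaussian P (wn t) Sigma_w)
  (gauss_v : forall t, centered_gaussian P (vn t) Sigma_v)
  (p_s_bounds : 0 < p_s <= 1) (p_c_bounds : 0 < p_c <= 1)
  (bernoulli_s : forall t, bernoulli_rv P p_s (s t))
  (bernoulli_nu : forall t, bernoulli_rv P p_c (nu t))
  (independence : mutually_independent P (source_sigma (x 0%N) wn vn s nu))
  (state_eq : forall t w, x t.+1 w = A *m x t w + B *m u t w + wn t w)
  (output_eq : forall t w, y t w = C *m x t w + vn t w)
  (cmd_causal : forall t,
     sigma_of (cmd t) `<=` controller_info s nu y xhat u t)
  (control_causal : forall t, sigma_vec (u t) `<=` actuator_info cmd nu t)
  (xhat_def : forall t, is_cond_exp P (sensor_info y u t) (x t) (xhat t))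
  (xtilde_def : forall t,
     is_cond_exp P (estimator_info s y xhat u t) (x t) (xtilde t)) :
  forall t : nat,
    {ae P, forall w,
      xtilde t w =
        (s t w)%:R *: xhat t w +
        (1 - (s t w)%:R) *: (A *m delayed xtilde t w + B *m delayed u t w)}.
Proof.
(* The applied control depends on dropouts and on commands up to time [t]; each command depends on
   estimator data of its own time and acknowledgements, all contained in [full_info t] by
   monotonicity. *)
have u_info t : sigma_vec (u t) `<=` <<s full_info y u s nu xhat t >>.
  apply: (subset_trans (control_causal t)); apply: sub_gen_sigma => E [k /= kt].
  have mono := full_info_mono (t := k) (t' := t).
  case=> [/(cmd_causal k)|nuE]; last by apply: sub_sigma_algebra; right; exists k.
  move: E; apply: sub_gen_sigma => E kE; apply: sub_sigma_algebra.
  by apply: mono => //; case: kE => [|[j _ jE]]; [left|right; exists j].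
apply: (xtilde_recursion (wn := wn) (vn := vn) (nu := nu) u_info state_eq output_eq
  independence) => //.
- exact: (proj1 gauss_x0).
- by move=> t; exact: (proj1 (gauss_w t)).
- by move=> t; exact: (proj1 (gauss_v t)).
- by move=> t; exact: (proj1 (bernoulli_s t)).
- by move=> t; exact: (proj1 (bernoulli_nu t)).
- by move=> i; exact: gaussian_integrable psd_Sigma_x0 gauss_x0.
- by move=> t i; exact: gaussian_integrable psd_Sigma_w (gauss_w t).
- by move=> i; exact: gaussian_mean0 psd_Sigma_x0 gauss_x0.
- by move=> t i; exact: gaussian_mean0 psd_Sigma_w (gauss_w t).
Qed.
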